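(* Let $X$ be a finite-dimensional normed space with a finite separating family $\mathcal{P}$ of thin cones. Let $S$ be a finite subset of $X$. Then \[|S|\leq \prod_{P\in\mathcal{P}} h(S,\leq_P).\]
   Context: All normed spaces are real. Let $\partial B_X$ be the unit sphere of $X$ and $o$ the origin. A subset $P\subseteq X$ is a convex cone if $x+y\in P$ and $\lambda x\in P$ whenever $x,y\in P$ and $\lambda\geq 0$ (cones are non-empty and need not be closed); it is proper if $P\cap(-P)=\{o\}$. A proper convex cone $P$ is thin if $\bigl((P\cap\partial B_X)-(P\cap\partial B_X)\bigr)\cap P=\{o\}$. A family $\mathcal{P}$ of proper convex cones in $X$ is separating if $\bigcup_{P\in\mathcal{P}}(P\cup(-P))=X$. For a proper convex cone $P$, $\leq_P$ is the partial order on $X$ defined by $a\leq_P b$ iff $b-a\in P$. For a finite set $S\subset X$, the height $h(S,\leq_P)$ is the largest cardinality of a chain in the finite poset $(S,\leq_P)$. *)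

(* Defs.v *)
From HB Require Import structures.
From mathcomp Require Import all_boot all_order all_algebra finmap.
From mathcomp Require Import boolp classical_sets reals topology normedtype.

Set Implicit Arguments.
Unset Strict Implicit.
Unset Printing Implicit Defensive.

Import Order.TTheory GRing.Theory Num.Theory.
Import numFieldNormedType.Exports.

Local Open Scope classical_set_scope.
Local Open Scope ring_scope.

#[short(type="normedVectType")]
HB.structure Definition NormedVector (K : numFieldType) :=
  {V of NormedModule K V & Vector K V}.

Section Cones.
Context {R : realType} {X : normedModType R}.
Implicit Types (A B P : set X) (C : set (set X)).

Definition unit_sphere : set X := [set x | `|x| = 1].

Definition opp_set A : set X := [set - x | x in A].

(* Difference of vectors; the set-theoretic difference is A `\` B. *)
Definition sub_set A B : set X := [set x - y | x in A & y in B].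

Definition convex_cone P : Prop :=
  [/\ P !=set0,
      forall x y, P x -> P y -> P (x + y)
    & forall (l : R) x, 0 <= l -> P x -> P (l *: x)].

Definition proper_cone P : Prop :=
  convex_cone P /\ P `&` opp_set P = [set 0].

(* The zero cone does not meet the unit sphere, so it is not thin: the left-hand
   side of the equation is then empty. *)
Definition thin_cone P : Prop :=
  proper_cone P /\
  sub_set (P `&` unit_sphere) (P `&` unit_sphere) `&` P = [set 0].

Definition separating C : Prop :=
  (forall P, C P -> proper_cone P) /\
  \bigcup_(P in C) (P `|` opp_set P) = [set: X].

Definition cone_le P (a b : X) : Prop := P (b - a).

End Cones.

Definition height {T : choiceType} (S : {fset T}) (le : T -> T -> Prop) : nat :=
  \max_(C <- fpowerset S | `[< total_on [set` C] le >]) #|` C|.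

(* Main.v *)
Require Import Defs.
From HB Require Import structures.
From mathcomp Require Import all_boot all_order all_algebra finmap.
From mathcomp Require Import boolp classical_sets reals topology normedtype.

(** Send each point of [S] to the tuple, indexed by the cones [P], of the
    heights of its sets of strict [P]-predecessors in [S]. Each coordinate is
    smaller than the height of [S]. Two distinct points are comparable for some
    [P], and then the [P]-coordinate of the smaller one is strictly smaller: a
    chain below it can be extended by the point itself. So the map is injective. *)

Lemma height_lt (T : choiceType) (le : T -> T -> Prop) (A B : {fset T}) (x : T) :
  le x x -> {in A, forall y, le y x} -> (A `<=` B)%fset -> x \in B ->
  x \notin A -> height A le < height B le.
Proof.
move=> lexx leAx AB xB xA.
have [C CA ->] : exists2 C : {fset T},
    (C `<=` A)%fset /\ total_on [set` C] le & height A le = #|` C|.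
  (* The empty set is a chain, so the maximum defining the height ranges over a non-empty family and
     is attained by some chain. *)
  have C0 : fset0 \in fpowerset A by rewrite fpowersetE fsub0set.
  have t0 : `[< total_on [set` (fset0 : {fset T})] le >].
    by apply/asboolP => y z /=; rewrite in_fset0.
  rewrite /height big_seq_fsetE /=.
  rewrite (bigmax_eq_arg (FSetSub C0)) //.
  case: arg_maxnP => //= C /asboolP totC _; exists (val C) => //.
  by split=> //; rewrite -fpowersetE (valP C).
case: CA => CA totC.
have xC : x \notin C by apply: contra xA => /(fsubsetP CA).
rewrite /height; apply: (@bigmaxn_sup_seq _ _ (x |` C)%fset).
- rewrite fpowersetE fsubUset fsub1set xB /=.
  exact: fsubset_trans CA AB.
- apply/asboolP => y z /=; rewrite !in_fset1U.
  case/orP => [/eqP->|yC] /orP[/eqP->|zC].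
  + by left.
  + by right; apply: leAx; apply: (fsubsetP CA).
  + by left; apply: leAx; apply: (fsubsetP CA).
  + exact: totC.
- by rewrite cardfsU1 xC.
Qed.

(** The order-theoretic core, free of cones: separation enters only as comparability of any two
    points of [S] under some [le i]. *)
Lemma card_le_prod_height (T I : choiceType) (F : {fset I}) (S : {fset T})
    (le : I -> T -> T -> Prop) :
  {in F, forall i x, le i x x} ->
  {in F, forall i x y z, le i x y -> le i y z -> le i x z} ->
  {in F, forall i x y, le i x y -> le i y x -> x = y} ->
  {in S &, forall x y, exists2 i, i \in F & le i x y \/ le i y x} ->
  #|` S| <= \prod_(i <- F) height S (le i).
Proof.
move=> refl trans anti cmp.
(* Strictness keeps [x] out of [below i x], so [height_lt] applies with [x] as the extra point, both
   inside [S] and inside [below i y] for [y] above [x]. *)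
pose below i x := [fset z in S | `[< le i z x >] && (z != x)]%fset.
have belowP i x y : reflect [/\ y \in S, le i y x & y != x] (y \in below i x).
  rewrite !inE /=; apply: (iffP and3P) => -[yS /asboolP leyx yx];
    by split=> //; apply/asboolP.
have below_lt i x : i \in F -> x \in S ->
    height (below i x) (le i) < height S (le i).
  move=> iF xS; apply: (@height_lt _ _ _ _ x) => //.
  - exact: refl.
  - by move=> y /belowP[].
  - by apply/fsubsetP => y /belowP[].
  - by apply/belowP => -[_ _ /eqP].
have mono i x y : i \in F -> x \in S -> le i x y -> x != y ->
    height (below i x) (le i) < height (below i y) (le i).
  move=> iF xS lexy xy; apply: (@height_lt _ _ _ _ x) => //.
  - exact: refl.
  - by move=> z /belowP[].
  - apply/fsubsetP => z /belowP[zS lezx zx]; apply/belowP; split=> //.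
      exact: trans lezx lexy.
    apply: contra zx => /eqP zy; apply/eqP; apply: (anti i) => //.
    by rewrite zy.
  - by apply/belowP.
  - by apply/belowP => -[_ _ /eqP].
(* Coordinates start at 0, for minimal points, and stay strictly below the height, so the codomain
   has exactly the product of the heights as cardinality. *)
pose f (x : S) : {dffun forall i : F, 'I_(height S (le (val i)))} :=
  [ffun i : F => Ordinal (below_lt (val i) (val x) (valP i) (valP x))].
have f_inj : injective f.
  move=> x y /ffunP fxy; apply/val_inj/eqP; apply/negPn/negP => xy.
  have [i iF lei] := cmp _ _ (valP x) (valP y).
  have := fxy (FSetSub iF); rewrite !ffunE => /(congr1 (@nat_of_ord _)) /= e.
  case: lei => [/mono|/mono].
  - by move=> /(_ iF (valP x) xy); rewrite e ltnn.
  - by rewrite eq_sym in xy; move=> /(_ iF (valP y) xy); rewrite e ltnn.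
rewrite cardfE (leq_trans (leq_card f f_inj)) // card_dep_ffun big_seq_fsetE /=.
rewrite foldrE big_map big_enum /=.
by under eq_bigr do rewrite card_ord.
Qed.

Theorem theorem37 (R : realType) (X : normedVectType R)
    (F : {fset (set X)}) (S : {fset X})
    (Fsep : separating [set` F])
    (Fthin : forall P : set X, P \in F -> thin_cone P) :
  (#|` S| <= \prod_(P <- F) height S (cone_le P))%N.
Proof.
case: Fsep => Fproper Fcover.
(* Reflexivity comes from scaling by 0, transitivity from additivity, antisymmetry from properness,
   and comparability from separation applied to [y - x]. *)
apply: card_le_prod_height => [P PF x|P PF x y z|P PF x y|x y xS yS];
  rewrite /cone_le.
- have [[[z Pz] _ scaleP] _] := Fproper P PF.
  by rewrite GRing.subrr -(GRing.scale0r z); apply: scaleP.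
- have [[_ addP _] _] := Fproper P PF => Pxy Pyz.
  by rewrite -(GRing.subrKA y); apply: addP.
- have [_ P0] := Fproper P PF => Pxy Pyx.
  have : (P `&` opp_set P)%classic (y - x)%R.
    by split=> //; exists (x - y)%R => //; rewrite GRing.opprB.
  by rewrite P0 => /= /eqP; rewrite GRing.subr_eq0 => /eqP.
- have : [set: X]%classic (y - x)%R by [].
  rewrite -Fcover => -[P PF [Pyx|[z Pz zE]]]; exists P => //; [by left|right].
  by rewrite -GRing.opprB -zE GRing.opprK.
Qed.
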